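(* Let $R$ be a commutative Noetherian ring of prime characteristic $p$ that is $F$-finite, let $I$ be an injective $R$-module, and fix an $(R,R)$-bimodule isomorphism $\Psi : {}_fI \to \operatorname{Hom}_{rR}(R_f, I)$. Then there is a contravariant functor $\mathbf{D}$ from the category of left $R[x,f]$-modules to the category of right $R[x,f]$-modules which maps a left $R[x,f]$-module $(H,\alpha)$ to the right $R[x,f]$-module $(H^\vee, D(\alpha))$, where $D(\alpha) : H^\vee\otimes_R R_f \to H^\vee$ is the right $R$-homomorphism given by $$(D(\alpha)(m\otimes r))(h) = \big(\Psi(m(\alpha(1\otimes h)))\big)(r) \quad\text{for all } m\in H^\vee,\ r\in R_f,\ h\in H.$$
   Context: $f : R \to R$, $f(r)=r^p$, is the Frobenius homomorphism; $R$ is $F$-finite if $f$ is a finite ring homomorphism. The Frobenius skew polynomial ring $R[x,f]$ is freely generated as a left $R$-module by $(x^i)_{i\ge 0}$, with multiplication subject to $xr = r^p x$ for $r\in R$. Since $R$ is commutative, $R$-modules are regarded as both left and right $R$-modules. Bimodules: $R_f$ is $R$ as an Abelian group with $r\cdot m\cdot s = r s^p m$; ${}_fI$ is $I$ as an Abelian group with $r\cdot z\cdot s = r^p s z$. $\operatorname{Hom}_{rR}(R_f,I)$ is the group of right $R$-homomorphisms $R_f\to I$ (additive $\psi$ with $\psi(rs^p)=\psi(r)s$), an $(R,R)$-bimodule via $(s\psi s')(r) = s\,\psi(s'r)$. An isomorphism $\Psi$ as in the claim exists when $R$ is $F$-finite and $I$ is injective. Notation $(H,\alpha)$: a left $R[x,f]$-module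 with underlying $R$-module $H$, where $\alpha : R_f\otimes_R H\to H$ is the left $R$-homomorphism with $xh=\alpha(1\otimes h)$; giving a left $R[x,f]$-module structure extending the $R$-module structure of $H$ is equivalent to giving such an $\alpha$. Notation $(M,\beta)$: a right $R[x,f]$-module with underlying $R$-module $M$, where $\beta : M\otimes_R R_f\to M$ is the right $R$-homomorphism with $mx=\beta(m\otimes 1)$; again giving the structure is equivalent to giving $\beta$. $G^\vee := \operatorname{Hom}_R(G,I)$ for an $R$-module $G$. On morphisms, $\mathbf{D}(\varphi)=\varphi^\vee$ for a left $R[x,f]$-homomorphism $\varphi$. *)

(* Defs.v *)
From HB Require Import structures.
From mathcomp Require Import all_boot all_algebra.
From mathcomp Require Import boolp.
From mathcomp Require Import freeg.

Set Implicit Arguments.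
Unset Strict Implicit.
Unset Printing Implicit Defensive.
Import GRing.Theory.
Local Open Scope ring_scope.
Local Open Scope quotient_scope.

Definition is_ideal (R : comNzRingType) (J : R -> Prop) : Prop :=
  [/\ J 0, forall x y, J x -> J y -> J (x + y) & forall r x, J x -> J (r * x)].

Definition finitely_generated (R : comNzRingType) (J : R -> Prop) : Prop :=
  exists (n : nat) (g : 'I_n -> R),
    forall x, J x <-> exists c : 'I_n -> R, x = \sum_i c i * g i.

Definition noetherian (R : comNzRingType) : Prop :=
  forall J : R -> Prop, is_ideal J -> finitely_generated J.

Definition finite_hom (A B : comNzRingType) (f : {rmorphism A -> B}) : Prop :=
  exists (n : nat) (e : 'I_n -> B),
    forall b, exists c : 'I_n -> A, b = \sum_i f (c i) * e i.

Definition frobenius (R : comNzRingType) (p : nat) (charRp : p \in [pchar R]) :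
  {rmorphism R -> R} := pFrobenius_aut charRp.

Lemma frobeniusE (R : comNzRingType) (p : nat) (charRp : p \in [pchar R]) r :
  frobenius charRp r = r ^+ p.
Proof. by []. Qed.

Definition F_finite (R : comNzRingType) (p : nat) (charRp : p \in [pchar R]) :
  Prop := finite_hom (frobenius charRp).

Definition injective_module (R : comNzRingType) (I : lmodType R) : Prop :=
  forall (A B : lmodType R) (i : {linear A -> B}) (g : {linear A -> I}),
    injective i -> exists h : {linear B -> I}, forall a, h (i a) = g a.

(* (R, R)-bimodules: the left action is the library's [*:], the right action
   is [ract]. *)

HB.mixin Record Lmodule_isBimodule (R : pzRingType) M of GRing.Lmodule R M := {
  ract : M -> R -> M;
  ractA : forall (m : M) r s, ract (ract m r) s = ract m (r * s);
  ract1 : forall m : M, ract m 1 = m;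
  ractDl : forall (m n : M) r, ract (m + n) r = ract m r + ract n r;
  ractDr : forall (m : M) r s, ract m (r + s) = ract m r + ract m s;
  scale_ract : forall r (m : M) s, r *: ract m s = ract (r *: m) s
}.

#[short(type="bimodType")]
HB.structure Definition Bimodule (R : pzRingType) :=
  {M of Lmodule_isBimodule R M & GRing.Lmodule R M}.

(* A module over a commutative ring, with both actions equal. *)
Definition symm (R : comNzRingType) (M : lmodType R) : Type := M.

Section Symm.
Variables (R : comNzRingType) (M : lmodType R).
HB.instance Definition _ := GRing.Lmodule.on (symm M).
Let symm_ract (m : symm M) (r : R) : symm M := r *: m.
Let symm_ractA m r s : symm_ract (symm_ract m r) s = symm_ract m (r * s).
Proof. by rewrite /symm_ract scalerA mulrC. Qed.
Let symm_ract1 m : symm_ract m 1 = m.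
Proof. exact: scale1r. Qed.
Let symm_ractDl m n r : symm_ract (m + n) r = symm_ract m r + symm_ract n r.
Proof. exact: scalerDr. Qed.
Let symm_ractDr m r s : symm_ract m (r + s) = symm_ract m r + symm_ract m s.
Proof. exact: scalerDl. Qed.
Let symm_scale_ract r m s : r *: symm_ract m s = symm_ract (r *: m) s.
Proof. by rewrite /symm_ract !scalerA mulrC. Qed.
HB.instance Definition _ := Lmodule_isBimodule.Build R (symm M)
  symm_ractA symm_ract1 symm_ractDl symm_ractDr symm_scale_ract.
End Symm.

(* R_f : the bimodule R with r . m . s = r * f s * m. *)
Definition Rf (R : comNzRingType) (f : {rmorphism R -> R}) : Type := R.

Section RfBimodule.
Variables (R : comNzRingType) (f : {rmorphism R -> R}).
HB.instance Definition _ := GRing.Zmodule.on (Rf f).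
Let Rf_scale (r : R) (m : Rf f) : Rf f := r * (m : R).
Let Rf_scaleA a b v : Rf_scale a (Rf_scale b v) = Rf_scale (a * b) v.
Proof. exact: mulrA. Qed.
Let Rf_scale1 : left_id 1 Rf_scale.
Proof. exact: mul1r. Qed.
Let Rf_scaleDr : right_distributive Rf_scale +%R.
Proof. exact: mulrDr. Qed.
Let Rf_scaleDl v : {morph Rf_scale^~ v : a b / a + b}.
Proof. by move=> a b; apply: mulrDl. Qed.
HB.instance Definition _ := GRing.Zmodule_isLmodule.Build R (Rf f)
  Rf_scaleA Rf_scale1 Rf_scaleDr Rf_scaleDl.
Let Rf_ract (m : Rf f) (s : R) : Rf f := f s * (m : R).
Let Rf_ractA m r s : Rf_ract (Rf_ract m r) s = Rf_ract m (r * s).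
Proof. by rewrite /Rf_ract mulrA rmorphM [f s * _]mulrC. Qed.
Let Rf_ract1 m : Rf_ract m 1 = m.
Proof. by rewrite /Rf_ract rmorph1 mul1r. Qed.
Let Rf_ractDl m n r : Rf_ract (m + n) r = Rf_ract m r + Rf_ract n r.
Proof. exact: mulrDr. Qed.
Let Rf_ractDr m r s : Rf_ract m (r + s) = Rf_ract m r + Rf_ract m s.
Proof. by rewrite /Rf_ract rmorphD; exact: mulrDl. Qed.
Let Rf_scale_ract r m s : r *: Rf_ract m s = Rf_ract (r *: m) s.
Proof. exact: mulrCA. Qed.
HB.instance Definition _ := Lmodule_isBimodule.Build R (Rf f)
  Rf_ractA Rf_ract1 Rf_ractDl Rf_ractDr Rf_scale_ract.

Lemma Rf_scaleE (r : R) (m : Rf f) : r *: m = r * (m : R) :> R.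
Proof. by []. Qed.
Lemma Rf_ractE (m : Rf f) (s : R) : ract m s = f s * (m : R) :> R.
Proof. by []. Qed.
End RfBimodule.

(* _f I : the bimodule I with r . z . s = (f r * s) z. *)
Definition fMod (R : comNzRingType) (f : {rmorphism R -> R}) (I : lmodType R) :
  Type := I.

Section FModBimodule.
Variables (R : comNzRingType) (f : {rmorphism R -> R}) (I : lmodType R).
HB.instance Definition _ := GRing.Zmodule.on (fMod f I).
Let fMod_scale (r : R) (z : fMod f I) : fMod f I := f r *: (z : I).
Let fMod_scaleA a b v : fMod_scale a (fMod_scale b v) = fMod_scale (a * b) v.
Proof. by rewrite /fMod_scale scalerA rmorphM. Qed.
Let fMod_scale1 : left_id 1 fMod_scale.
Proof. by move=> z; rewrite /fMod_scale rmorph1 scale1r. Qed.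
Let fMod_scaleDr : right_distributive fMod_scale +%R.
Proof. by move=> r; apply: scalerDr. Qed.
Let fMod_scaleDl v : {morph fMod_scale^~ v : a b / a + b}.
Proof. by move=> a b; rewrite /fMod_scale rmorphD; apply: scalerDl. Qed.
HB.instance Definition _ := GRing.Zmodule_isLmodule.Build R (fMod f I)
  fMod_scaleA fMod_scale1 fMod_scaleDr fMod_scaleDl.
Let fMod_ract (z : fMod f I) (s : R) : fMod f I := s *: (z : I).
Let fMod_ractA m r s : fMod_ract (fMod_ract m r) s = fMod_ract m (r * s).
Proof. by rewrite /fMod_ract scalerA mulrC. Qed.
Let fMod_ract1 m : fMod_ract m 1 = m.
Proof. exact: (@scale1r _ I). Qed.
Let fMod_ractDl m n r : fMod_ract (m + n) r = fMod_ract m r + fMod_ract n r.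
Proof. exact: (@scalerDr _ I). Qed.
Let fMod_ractDr m r s : fMod_ract m (r + s) = fMod_ract m r + fMod_ract m s.
Proof. exact: (@scalerDl _ I). Qed.
Let fMod_scale_ract r m s : r *: fMod_ract m s = fMod_ract (r *: m) s.
Proof.
change (f r *: (s *: (m : I)) = s *: (f r *: (m : I))).
by rewrite !scalerA mulrC.
Qed.
HB.instance Definition _ := Lmodule_isBimodule.Build R (fMod f I)
  fMod_ractA fMod_ract1 fMod_ractDl fMod_ractDr fMod_scale_ract.

Lemma fMod_scaleE (r : R) (z : fMod f I) : r *: z = f r *: (z : I) :> I.
Proof. by []. Qed.
Lemma fMod_ractE (z : fMod f I) (s : R) : ract z s = s *: (z : I) :> I.
Proof. by []. Qed.
End FModBimodule.

(* Right R-homomorphisms M -> N between bimodules; they form a bimodule with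
   (s psi s') m = s *: psi (s' *: m). *)
Record rhom (R : pzRingType) (M N : bimodType R) := RHom {
  rhom_fun :> M -> N;
  rhomD : forall m n, rhom_fun (m + n) = rhom_fun m + rhom_fun n;
  rhom_ract : forall m r, rhom_fun (ract m r) = ract (rhom_fun m) r
}.

Section RHomBimodule.
Variables (R : pzRingType) (M N : bimodType R).
Implicit Types psi : rhom M N.

Lemma rhom_ext psi1 psi2 : psi1 =1 psi2 -> psi1 = psi2.
Proof.
case: psi1 psi2 => [g gD gr] [h hD hr] /= /funext e.
by case: _ / e in hD hr *; congr RHom; apply: Prop_irrelevance.
Qed.

Lemma rhom0 psi : psi 0 = 0.
Proof. by apply: (addIr (psi 0)); rewrite -rhomD !add0r. Qed.

HB.instance Definition _ := gen_eqMixin (rhom M N).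
HB.instance Definition _ := gen_choiceMixin (rhom M N).

Lemma ract0l (r : R) : ract (0 : N) r = 0.
Proof. by apply: (addIr (ract (0 : N) r)); rewrite -ractDl !add0r. Qed.

Lemma ractNl (n : N) (r : R) : ract (- n) r = - ract n r.
Proof. by apply: (addIr (ract n r)); rewrite -ractDl !addNr ract0l. Qed.

Let zeroD (m n : M) : 0 = 0 + 0 :> N.
Proof. by rewrite addr0. Qed.
Let zero_ract (m : M) (r : R) : 0 = ract (0 : N) r.
Proof. by rewrite ract0l. Qed.
Definition rhom_zero := @RHom R M N (fun=> 0) zeroD zero_ract.

Let addD psi1 psi2 m n :
  psi1 (m + n) + psi2 (m + n) = (psi1 m + psi2 m) + (psi1 n + psi2 n).
Proof. by rewrite !rhomD addrACA. Qed.
Let add_ract psi1 psi2 m r :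
  psi1 (ract m r) + psi2 (ract m r) = ract (psi1 m + psi2 m) r.
Proof. by rewrite !rhom_ract ractDl. Qed.
Definition rhom_add psi1 psi2 :=
  @RHom R M N (fun m => psi1 m + psi2 m) (addD psi1 psi2) (add_ract psi1 psi2).

Let oppD psi m n : - psi (m + n) = - psi m + - psi n.
Proof. by rewrite rhomD opprD. Qed.
Let opp_ract psi m r : - psi (ract m r) = ract (- psi m) r.
Proof. by rewrite rhom_ract ractNl. Qed.
Definition rhom_opp psi := @RHom R M N (fun m => - psi m) (oppD psi) (opp_ract psi).

Let addA : associative rhom_add.
Proof. by move=> x y z; apply: rhom_ext => m /=; rewrite addrA. Qed.
Let addC : commutative rhom_add.
Proof. by move=> x y; apply: rhom_ext => m /=; rewrite addrC. Qed.
Let add0 : left_id rhom_zero rhom_add.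
Proof. by move=> x; apply: rhom_ext => m /=; rewrite add0r. Qed.
Let addN : left_inverse rhom_zero rhom_opp rhom_add.
Proof. by move=> x; apply: rhom_ext => m /=; rewrite addNr. Qed.
HB.instance Definition _ :=
  GRing.isZmodule.Build (rhom M N) addA addC add0 addN.

Let scaleD s psi m n : s *: psi (m + n) = s *: psi m + s *: psi n.
Proof. by rewrite rhomD scalerDr. Qed.
Let scale_ractm s psi m r : s *: psi (ract m r) = ract (s *: psi m) r.
Proof. by rewrite rhom_ract scale_ract. Qed.
Definition rhom_scale s psi :=
  @RHom R M N (fun m => s *: psi m) (scaleD s psi) (scale_ractm s psi).
Let scaleA a b psi : rhom_scale a (rhom_scale b psi) = rhom_scale (a * b) psi.
Proof. by apply: rhom_ext => m /=; rewrite scalerA. Qed.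
Let scale1 : left_id 1 rhom_scale.
Proof. by move=> psi; apply: rhom_ext => m /=; rewrite scale1r. Qed.
Let scaleDr : right_distributive rhom_scale +%R.
Proof. by move=> a x y; apply: rhom_ext => m /=; rewrite scalerDr. Qed.
Let scaleDl psi : {morph rhom_scale^~ psi : a b / a + b}.
Proof. by move=> a b; apply: rhom_ext => m /=; rewrite scalerDl. Qed.
HB.instance Definition _ := GRing.Zmodule_isLmodule.Build R (rhom M N)
  scaleA scale1 scaleDr scaleDl.

Let precD psi s m n : psi (s *: (m + n)) = psi (s *: m) + psi (s *: n).
Proof. by rewrite scalerDr rhomD. Qed.
Let prec_ract psi s m r : psi (s *: ract m r) = ract (psi (s *: m)) r.
Proof. by rewrite scale_ract rhom_ract. Qed.
Definition rhom_prec psi s :=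
  @RHom R M N (fun m => psi (s *: m)) (precD psi s) (prec_ract psi s).
Let precA psi r s : rhom_prec (rhom_prec psi r) s = rhom_prec psi (r * s).
Proof. by apply: rhom_ext => m /=; rewrite scalerA. Qed.
Let prec1 psi : rhom_prec psi 1 = psi.
Proof. by apply: rhom_ext => m /=; rewrite scale1r. Qed.
Let precDl x y r : rhom_prec (x + y) r = rhom_prec x r + rhom_prec y r.
Proof. exact: rhom_ext. Qed.
Let precDr x r s : rhom_prec x (r + s) = rhom_prec x r + rhom_prec x s.
Proof. by apply: rhom_ext => m /=; rewrite scalerDl rhomD. Qed.
Let scale_prec r x s : r *: rhom_prec x s = rhom_prec (r *: x) s.
Proof. exact: rhom_ext. Qed.
HB.instance Definition _ := Lmodule_isBimodule.Build R (rhom M N)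
  precA prec1 precDl precDr scale_prec.

Lemma rhom_scaleE (s : R) psi m : (s *: psi) m = s *: psi m.
Proof. by []. Qed.
Lemma rhom_ractE psi (s : R) m : ract psi s m = psi (s *: m).
Proof. by []. Qed.
End RHomBimodule.

Record bimod_iso (R : pzRingType) (M N : bimodType R) := BimodIso {
  bimod_iso_fun :> M -> N;
  bimod_isoD : forall m n,
    bimod_iso_fun (m + n) = bimod_iso_fun m + bimod_iso_fun n;
  bimod_isoZ : forall r m, bimod_iso_fun (r *: m) = r *: bimod_iso_fun m;
  bimod_iso_ract : forall m r,
    bimod_iso_fun (ract m r) = ract (bimod_iso_fun m) r;
  bimod_iso_bij : bijective bimod_iso_fun
}.

Lemma morphBD (A B : zmodType) (g : A -> B) :
  {morph g : x y / x - y} -> {morph g : x y / x + y}.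
Proof.
move=> gB; have g0 : g 0 = 0 by rewrite -(subrr 0) gB subrr.
by move=> x y; rewrite -[in LHS](opprK y) -[- y]sub0r !gB g0 sub0r opprK.
Qed.

(* M (x)_R N : the free abelian group on M * N modulo the subgroup generated
   by the usual relations. *)
Section Tensor.
Variables (R : pzRingType) (M N : bimodType R).

Local Notation gen m n := (<< (m, n) >> : {freeg (M * N)%type / int}).

Inductive tensor_rel : {freeg (M * N)%type / int} -> Prop :=
| tensor_rel0 : tensor_rel 0
| tensor_relB x y : tensor_rel x -> tensor_rel y -> tensor_rel (x - y)
| tensor_relDl m1 m2 n : tensor_rel (gen (m1 + m2) n - gen m1 n - gen m2 n)
| tensor_relDr m n1 n2 : tensor_rel (gen m (n1 + n2) - gen m n1 - gen m n2)
| tensor_relZ m r n : tensor_rel (gen (ract m r) n - gen m (r *: n)).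

Definition tensor_relb : {pred {freeg (M * N)%type / int}} :=
  fun x => `[< tensor_rel x >].

Lemma tensor_relb_closed : zmod_closed tensor_relb.
Proof.
split=> [|x y]; first exact/asboolP/tensor_rel0.
by move=> /asboolP rx /asboolP ry; apply/asboolP/tensor_relB.
Qed.
HB.instance Definition _ :=
  GRing.isZmodClosed.Build {freeg (M * N)%type / int} tensor_relb
  tensor_relb_closed.

Definition tensor : Type := Quotient.quot tensor_relb.
HB.instance Definition _ := GRing.Zmodule.on tensor.

Definition tensor_pi (x : {freeg (M * N)%type / int}) : tensor :=
  \pi_(Quotient.quot tensor_relb) x.

Definition tens (m : M) (n : N) : tensor := tensor_pi (gen m n).

Lemma tensor_pi_eq x y : tensor_pi x = tensor_pi y <-> tensor_rel (x - y).
Proof.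
split=> [/eqP|rxy]; first by rewrite -Quotient.idealrBE => /asboolP.
by apply/eqP; rewrite -Quotient.idealrBE; apply/asboolP.
Qed.

Lemma tensor_piB x y : tensor_pi (x - y) = tensor_pi x - tensor_pi y.
Proof. exact: raddfB. Qed.

Lemma tensor_piD x y : tensor_pi (x + y) = tensor_pi x + tensor_pi y.
Proof. exact: raddfD. Qed.

Lemma tensor_pi0 : tensor_pi 0 = 0.
Proof. exact: raddf0. Qed.

Lemma tensor_piN x : tensor_pi (- x) = - tensor_pi x.
Proof. exact: raddfN. Qed.

Lemma tensor_piP t : exists x, t = tensor_pi x.
Proof. by exists (repr t); rewrite /tensor_pi reprK. Qed.

Lemma tensDl m1 m2 n : tens (m1 + m2) n = tens m1 n + tens m2 n.
Proof.
rewrite /tens -tensor_piD; apply/tensor_pi_eq.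
by rewrite opprD addrA; apply: tensor_relDl.
Qed.

Lemma tensDr m n1 n2 : tens m (n1 + n2) = tens m n1 + tens m n2.
Proof.
rewrite /tens -tensor_piD; apply/tensor_pi_eq.
by rewrite opprD addrA; apply: tensor_relDr.
Qed.

Lemma tens_ract m r n : tens (ract m r) n = tens m (r *: n).
Proof. by apply/tensor_pi_eq; apply: tensor_relZ. Qed.

Lemma tens_ind (P : tensor -> Prop) : P 0 ->
  (forall m n t, P t -> P (tens m n + t)) ->
  (forall m n t, P t -> P (- tens m n + t)) -> forall t, P t.
Proof.
move=> P0 PD PB t; have [x ->] := tensor_piP t.
suff Pgen k mn y : P (tensor_pi y) ->
    P (tensor_pi ((<< k *g mn >> : {freeg (M * N)%type / int}) + y)).
  rewrite -(freeg_sumE x).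
  elim: (dom _) => [|mn s IHs]; rewrite ?big_nil ?tensor_pi0 // big_cons.
  exact: Pgen.
rewrite -[k]intz -freegU_mulz; case: mn => m n Py.
case: k => k; rewrite ?NegzE ?mulrNz -pmulrn.
  by elim: k => [|k IHk]; rewrite ?mulr0n ?add0r // mulrS -addrA tensor_piD; apply: PD.
elim: k.+1 => [|j IHj]; first by rewrite mulr0n oppr0 add0r.
by rewrite mulrS opprD -addrA tensor_piD tensor_piN; apply: PB.
Qed.

Record balanced (A : zmodType) (phi : M -> N -> A) : Prop := Balanced {
  balDl : forall m1 m2 n, phi (m1 + m2) n = phi m1 n + phi m2 n;
  balDr : forall m n1 n2, phi m (n1 + n2) = phi m n1 + phi m n2;
  bal_ract : forall m r n, phi (ract m r) n = phi m (r *: n)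
}.

(* The additive map sending [tens m n] to [phi m n] when [phi] is balanced. *)
Definition tensor_lift (A : zmodType) (phi : M -> N -> A) (t : tensor) : A :=
  fglift (fun mn => phi mn.1 mn.2 : zmodule A) (repr t).

Section Lift.
Variables (A : zmodType) (phi : M -> N -> A).
Hypothesis phi_bal : balanced phi.

Local Notation L := (fglift (fun mn => phi mn.1 mn.2 : zmodule A)).

Let LB x y : L (x - y) = L x - L y.
Proof. exact: lift_is_additive. Qed.

Let L0 : L 0 = 0.
Proof. by rewrite -(subrr 0) LB subrr. Qed.

Let L_gen m n : L (gen m n) = phi m n.
Proof. by rewrite liftU scale1r. Qed.

Let L_rel x : tensor_rel x -> L x = 0.
Proof.
elim=> [|{}x y _ Lx _ Ly|m1 m2 n|m n1 n2|m r n]; rewrite ?L0 ?LB ?L_gen //=.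
- by rewrite Lx Ly subrr.
- by rewrite (balDl phi_bal) addrAC addrK subrr.
- by rewrite (balDr phi_bal) addrAC addrK subrr.
- by rewrite (bal_ract phi_bal) subrr.
Qed.

Let L_pi x : tensor_lift phi (tensor_pi x) = L x.
Proof.
apply/eqP; rewrite -subr_eq0 -LB; apply/eqP/L_rel/tensor_pi_eq.
by rewrite /tensor_pi reprK.
Qed.

Lemma tensor_lift_tens m n : tensor_lift phi (tens m n) = phi m n.
Proof. by rewrite L_pi L_gen. Qed.

Lemma tensor_liftB t u :
  tensor_lift phi (t - u) = tensor_lift phi t - tensor_lift phi u.
Proof.
have [[x ->] [y ->]] := (tensor_piP t, tensor_piP u).
by rewrite -tensor_piB !L_pi LB.
Qed.
End Lift.
End Tensor.

Arguments tens {R M N} m n.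

(* r . (m (x) n) . s = (r m) (x) (n s) *)
Section TensorBimodule.
Variables (R : pzRingType) (M N : bimodType R).

Definition tensor_scale (r : R) : tensor M N -> tensor M N :=
  tensor_lift (fun m n => tens (r *: m) n).
Definition tensor_ract (t : tensor M N) (s : R) : tensor M N :=
  tensor_lift (fun m n => tens m (ract n s)) t.

Let scale_bal r : balanced (fun (m : M) (n : N) => tens (r *: m) n).
Proof.
split=> *; first by rewrite scalerDr tensDl.
  by rewrite tensDr.
by rewrite scale_ract tens_ract.
Qed.
Let ract_bal s : balanced (fun (m : M) (n : N) => tens m (ract n s)).
Proof.
split=> *; first by rewrite tensDl.
  by rewrite ractDl tensDr.
by rewrite -scale_ract tens_ract.
Qed.

Lemma tensor_scale_tens r (m : M) (n : N) :
  tensor_scale r (tens m n) = tens (r *: m) n.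
Proof. exact: tensor_lift_tens (scale_bal r) _ _. Qed.
Lemma tensor_ract_tens (m : M) (n : N) s :
  tensor_ract (tens m n) s = tens m (ract n s).
Proof. exact: tensor_lift_tens (ract_bal s) _ _. Qed.

(* Additive maps on the tensor product agreeing on pure tensors are equal. *)
Lemma tensor_ext (A : zmodType) (g h : tensor M N -> A) :
  {morph g : t u / t - u} -> {morph h : t u / t - u} ->
  (forall m n, g (tens m n) = h (tens m n)) -> g =1 h.
Proof.
move=> gB hB gh.
have g0 : g 0 = 0 by rewrite -[in LHS](subrr 0) gB subrr.
have h0 : h 0 = 0 by rewrite -[in LHS](subrr 0) hB subrr.
have [gD hD] := (morphBD gB, morphBD hB).
elim/tens_ind => [|m n t IHt|m n t IHt]; first by rewrite g0 h0.
  by rewrite gD hD gh IHt.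
by rewrite gD hD -[- tens m n]sub0r gB hB g0 h0 gh IHt.
Qed.

Let scaleB r : {morph tensor_scale r : t u / t - u}.
Proof. exact: tensor_liftB (scale_bal r). Qed.
Let ractB s : {morph tensor_ract^~ s : t u / t - u}.
Proof. exact: tensor_liftB (ract_bal s). Qed.

Let scaleA a b t : tensor_scale a (tensor_scale b t) = tensor_scale (a * b) t.
Proof.
move: t; apply: tensor_ext => [t u|t u|m n]; rewrite ?scaleB //.
by rewrite !tensor_scale_tens scalerA.
Qed.
Let scale1 : left_id 1 tensor_scale.
Proof.
apply: tensor_ext => [t u|//|m n]; rewrite ?scaleB //.
by rewrite tensor_scale_tens scale1r.
Qed.
Let scaleDr : right_distributive tensor_scale +%R.
Proof. by move=> r; apply: morphBD; apply: scaleB. Qed.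
Let scaleDl t : {morph tensor_scale^~ t : a b / a + b}.
Proof.
move=> a b; move: t; apply: tensor_ext => [t u|t u|m n]; rewrite ?scaleB //.
  by rewrite opprD addrACA.
by rewrite !tensor_scale_tens scalerDl tensDl.
Qed.
HB.instance Definition _ := GRing.Zmodule_isLmodule.Build R (tensor M N)
  scaleA scale1 scaleDr scaleDl.

Let ractA t r s : tensor_ract (tensor_ract t r) s = tensor_ract t (r * s).
Proof.
move: t; apply: tensor_ext => [t u|t u|m n]; rewrite ?ractB //.
by rewrite !tensor_ract_tens ractA.
Qed.
Let ract1 t : tensor_ract t 1 = t.
Proof.
move: t; apply: tensor_ext => [t u|//|m n]; rewrite ?ractB //.
by rewrite tensor_ract_tens ract1.
Qed.
Let ractDl t u s : tensor_ract (t + u) s = tensor_ract t s + tensor_ract u s.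
Proof. exact: (morphBD (ractB s)). Qed.
Let ractDr t r s : tensor_ract t (r + s) = tensor_ract t r + tensor_ract t s.
Proof.
move: t; apply: tensor_ext => [t u|t u|m n]; rewrite ?ractB //.
  by rewrite opprD addrACA.
by rewrite !tensor_ract_tens ractDr tensDr.
Qed.
Let scale_ractC r t s :
  tensor_scale r (tensor_ract t s) = tensor_ract (tensor_scale r t) s.
Proof.
move: t; apply: tensor_ext => [t u|t u|m n]; rewrite ?(scaleB, ractB) //.
by rewrite !(tensor_scale_tens, tensor_ract_tens).
Qed.
HB.instance Definition _ := Lmodule_isBimodule.Build R (tensor M N)
  ractA ract1 ractDl ractDr scale_ractC.

Lemma scale_tens (r : R) (m : M) (n : N) : r *: tens m n = tens (r *: m) n.
Proof. exact: tensor_scale_tens. Qed.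
Lemma ract_tens (m : M) (n : N) (s : R) :
  ract (tens m n) s = tens m (ract n s).
Proof. exact: tensor_ract_tens. Qed.
End TensorBimodule.

(* The dual Hom_R(G, I), with pointwise operations. *)
Definition dual (R : comNzRingType) (G I : lmodType R) : Type :=
  {linear G -> I}.

Section Dual.
Variables (R : comNzRingType) (G I : lmodType R).

Definition dual_fun (m : dual G I) : {linear G -> I} := m.

Lemma dual_ext (m1 m2 : dual G I) : dual_fun m1 =1 dual_fun m2 -> m1 = m2.
Proof.
move: m1 m2 => -[g [[gN] [gZ]]] [h [[hN] [hZ]]] /= /funext e.
case: _ / e in hN hZ *.
by rewrite (Prop_irrelevance gN hN) (Prop_irrelevance gZ hZ).
Qed.

HB.instance Definition _ := gen_eqMixin (dual G I).
HB.instance Definition _ := gen_choiceMixin (dual G I).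

Definition dual_zero : dual G I := \0 : {linear G -> I}.
Definition dual_add (m1 m2 : dual G I) : dual G I :=
  dual_fun m1 \+ dual_fun m2 : {linear G -> I}.
Definition dual_opp (m : dual G I) : dual G I :=
  \- dual_fun m : {linear G -> I}.
Definition dual_scale (r : R) (m : dual G I) : dual G I :=
  r \*: dual_fun m : {linear G -> I}.

Let addA : associative dual_add.
Proof. by move=> x y z; apply: dual_ext => g /=; rewrite addrA. Qed.
Let addC : commutative dual_add.
Proof. by move=> x y; apply: dual_ext => g /=; rewrite addrC. Qed.
Let add0 : left_id dual_zero dual_add.
Proof. by move=> x; apply: dual_ext => g /=; rewrite add0r. Qed.
Let addN : left_inverse dual_zero dual_opp dual_add.
Proof. by move=> x; apply: dual_ext => g /=; rewrite addNr. Qed.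
HB.instance Definition _ :=
  GRing.isZmodule.Build (dual G I) addA addC add0 addN.

Let scaleA a b v : dual_scale a (dual_scale b v) = dual_scale (a * b) v.
Proof. by apply: dual_ext => g /=; rewrite scalerA. Qed.
Let scale1 : left_id 1 dual_scale.
Proof. by move=> v; apply: dual_ext => g /=; rewrite scale1r. Qed.
Let scaleDr : right_distributive dual_scale +%R.
Proof. by move=> a x y; apply: dual_ext => g /=; rewrite scalerDr. Qed.
Let scaleDl v : {morph dual_scale^~ v : a b / a + b}.
Proof. by move=> a b; apply: dual_ext => g /=; rewrite scalerDl. Qed.
HB.instance Definition _ := GRing.Zmodule_isLmodule.Build R (dual G I)
  scaleA scale1 scaleDr scaleDl.
End Dual.

Coercion dual_fun : dual >-> GRing.Linear.type.

(* The skew polynomial ring R[x, f]: the additive group of {poly R}, whose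
   'X^i form a left R-basis, with the product
   (a x^i) * q = a f^i(q) x^i, f acting on coefficients. *)
Definition skew_poly (R : comNzRingType) (f : {rmorphism R -> R}) : Type :=
  {poly R}.

Section SkewPoly.
Variables (R : comNzRingType) (f : {rmorphism R -> R}).

HB.instance Definition _ := GRing.Zmodule.on (skew_poly f).

Definition skew_mul (p q : skew_poly f) : skew_poly f :=
  \sum_(i < size (p : {poly R}))
     (p : {poly R})`_i *: (iter i (map_poly f) (q : {poly R}) * 'X^i).

Implicit Types (p q r : {poly R}) (a b : R).

Local Notation S i := (iter i (map_poly f)).

Let S_D i : {morph S i : p q / p + q}.
Proof. by elim: i => // i IHi p q /=; rewrite IHi rmorphD. Qed.
Let S_M i : {morph S i : p q / p * q}.
Proof. by elim: i => // i IHi p q /=; rewrite IHi rmorphM. Qed.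
Let S_X i j : S i 'X^j = 'X^j.
Proof. by elim: i => //= i ->; rewrite map_polyXn. Qed.
Let S_1 i : S i 1 = 1.
Proof. by elim: i => //= i ->; rewrite rmorph1. Qed.
Let S_0 i : S i 0 = 0.
Proof. by elim: i => //= i ->; rewrite rmorph0. Qed.
Let S_C i a : S i a%:P = (iter i f a)%:P.
Proof. by elim: i => //= i ->; rewrite map_polyC. Qed.

Let skew_mul_le n p q : (size p <= n)%N ->
  skew_mul p q = \sum_(i < n) p`_i *: (S i q * 'X^i).
Proof.
move=> le_pn; rewrite /skew_mul (big_ord_widen n (fun i => p`_i *: (S i q * 'X^i))) //.
rewrite big_mkcond /=; apply: eq_bigr => i _.
by case: ltnP => // le_pi; rewrite nth_default ?scale0r.
Qed.

Let mulDl : left_distributive skew_mul +%R.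
Proof.
move=> p q r; pose n := maxn (size (p : {poly R})) (size (q : {poly R})).
rewrite (@skew_mul_le n (p + q : {poly R}) r) ?size_polyD //.
rewrite (@skew_mul_le n p r) ?leq_maxl // (@skew_mul_le n q r) ?leq_maxr //.
rewrite -[RHS]big_split /=; apply: eq_bigr => i _.
by rewrite coefD scalerDl.
Qed.
Let mulDr : right_distributive skew_mul +%R.
Proof.
move=> p q r; rewrite /skew_mul -[RHS]big_split /=; apply: eq_bigr => i _.
by rewrite S_D mulrDl scalerDr.
Qed.

Lemma skew_mul_monom a i q :
  skew_mul (a *: 'X^i : {poly R}) q = a *: (S i q * 'X^i).
Proof.
have le_s : (size (a *: 'X^i : {poly R}) <= i.+1)%N.
  by rewrite (leq_trans (size_scale_leq _ _)) ?size_polyXn.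
rewrite (@skew_mul_le i.+1 _ q le_s) big_ord_recr /= coefZ coefXn eqxx mulr1.
rewrite big1 ?add0r // => j _.
by rewrite coefZ coefXn (ltn_eqF (ltn_ord j)) mulr0 scale0r.
Qed.

Lemma skew_poly_ind (P : {poly R} -> Prop) : P 0 ->
  (forall a i q, P q -> P (a *: 'X^i + q)) -> forall q, P q.
Proof.
move=> P0 PD q; rewrite -[q]coefK poly_def.
by apply: big_rec => // i p _ Pp; apply: PD.
Qed.

Let mul0l q : skew_mul (0 : {poly R}) q = 0.
Proof. by rewrite /skew_mul size_poly0 big_ord0. Qed.
Let mul0r q : skew_mul q (0 : {poly R}) = 0.
Proof.
by rewrite /skew_mul big1 // => i _; rewrite S_0 mul0r scaler0.
Qed.

Let mulA : associative skew_mul.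
Proof.
move=> p q r; elim/skew_poly_ind: p => [|a i p IHp]; first by rewrite !mul0l.
rewrite [LHS]mulDl IHp [skew_mul (_ + _) q]mulDl [RHS]mulDl; congr (_ + _).
elim/skew_poly_ind: q {IHp} => [|b j q IHq].
  by rewrite mul0l mul0r mul0l.
rewrite [skew_mul (_ + _) r]mulDl [LHS]mulDr IHq.
rewrite [skew_mul _ (_ + _)]mulDr [RHS]mulDl; congr (_ + _).
have S_Z u : S i (b *: u) = iter i f b *: S i u.
  by rewrite -!mul_polyC S_M S_C.
rewrite [skew_mul (b *: 'X^j) r]skew_mul_monom.
rewrite [skew_mul (a *: 'X^i) (b *: 'X^j)]skew_mul_monom S_Z S_X.
rewrite -scalerAl scalerA -exprD addnC [RHS]skew_mul_monom.
rewrite [LHS]skew_mul_monom S_Z S_M S_X -scalerAl scalerA.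
by rewrite -iterD -mulrA -exprD [(j + i)%N]addnC.
Qed.

Let mul1 : left_id (1 : {poly R}) skew_mul.
Proof.
move=> q; have -> : 1 = 1 *: 'X^0 :> {poly R} by rewrite expr0 scale1r.
by rewrite skew_mul_monom scale1r expr0 mulr1.
Qed.
Let mulr_1 : right_id (1 : {poly R}) skew_mul.
Proof.
move=> q; rewrite /skew_mul -[RHS]coefK poly_def; apply: eq_bigr => i _.
by rewrite S_1 mul1r.
Qed.

HB.instance Definition _ := GRing.Zmodule_isNzRing.Build (skew_poly f)
  mulA mul1 mulr_1 mulDl mulDr (oner_neq0 {poly R}).

Definition skew_const (a : R) : skew_poly f := a%:P.
Definition skew_x : skew_poly f := 'X.

Lemma skew_constD : {morph skew_const : a b / a + b}.
Proof. exact: polyCD. Qed.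
Lemma skew_const1 : skew_const 1 = 1.
Proof. by []. Qed.

Lemma skew_const_mul a (q : skew_poly f) :
  skew_const a * q = a *: (q : {poly R}) :> {poly R}.
Proof.
rewrite -[LHS]/(skew_mul (skew_const a) q).
have -> : skew_const a = a *: 'X^0 :> {poly R} by rewrite expr0 alg_polyC.
by rewrite skew_mul_monom expr0 mulr1.
Qed.

Lemma skew_constM : {morph skew_const : a b / a * b}.
Proof. by move=> a b; rewrite skew_const_mul /skew_const polyCM mul_polyC. Qed.

Lemma skew_x_mul (q : skew_poly f) :
  skew_x * q = map_poly f (q : {poly R}) * 'X :> {poly R}.
Proof.
rewrite -[LHS]/(skew_mul skew_x q).
have -> : skew_x = 1 *: 'X^1 :> {poly R} by rewrite scale1r.
by rewrite skew_mul_monom scale1r.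
Qed.

Lemma skew_x_const a : skew_x * skew_const a = skew_const (f a) * skew_x.
Proof.
rewrite skew_const_mul; apply: etrans (skew_x_mul _) _.
by rewrite map_polyC mul_polyC.
Qed.

Lemma skew_polyE (q : skew_poly f) :
  q = \sum_(i < size (q : {poly R}))
        skew_const (q : {poly R})`_i * skew_x ^+ i.
Proof.
have xE i : skew_x ^+ i = 'X^i :> {poly R}.
  elim: i => // i IHi; rewrite exprS; apply: etrans (skew_x_mul _) _.
  by rewrite IHi map_polyXn -exprSr.
rewrite -[LHS](@coefK R) poly_def; apply: eq_bigr => i _.
by rewrite skew_const_mul xE.
Qed.
End SkewPoly.

(* The underlying R-module of a left R[x, f]-module. *)
Definition restr (R : comNzRingType) (f : {rmorphism R -> R})
  (H : lmodType (skew_poly f)) : Type := H.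

Section LeftModule.
Variables (R : comNzRingType) (f : {rmorphism R -> R}).
Variable H : lmodType (skew_poly f).

HB.instance Definition _ := GRing.Zmodule.on (restr H).

Let restr_scale (r : R) (h : restr H) : restr H := skew_const f r *: (h : H).
Let restr_scaleA a b v :
  restr_scale a (restr_scale b v) = restr_scale (a * b) v.
Proof. by rewrite /restr_scale scalerA -skew_constM. Qed.
Let restr_scale1 : left_id 1 restr_scale.
Proof. by move=> v; rewrite /restr_scale skew_const1 (@scale1r _ H). Qed.
Let restr_scaleDr : right_distributive restr_scale +%R.
Proof. by move=> a x y; apply: (@scalerDr _ H). Qed.
Let restr_scaleDl v : {morph restr_scale^~ v : a b / a + b}.
Proof. by move=> a b; rewrite /restr_scale skew_constD (@scalerDl _ H). Qed.
HB.instance Definition _ := GRing.Zmodule_isLmodule.Build R (restr H)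
  restr_scaleA restr_scale1 restr_scaleDr restr_scaleDl.

Lemma restr_scaleE (r : R) (h : restr H) :
  r *: h = skew_const f r *: (h : H) :> H.
Proof. by []. Qed.

(* alpha (r (x) h) = (r x) h; in particular alpha (1 (x) h) = x h. *)
Definition alpha : tensor (Rf f) (symm (restr H)) -> restr H :=
  tensor_lift
    (fun (r : Rf f) (h : symm (restr H)) =>
       (skew_const f r * skew_x f) *: (h : H) : restr H).

Let alpha_bal : balanced (fun (r : Rf f) (h : symm (restr H)) =>
  (skew_const f r * skew_x f) *: (h : H) : restr H).
Proof.
split=> [r1 r2 h|r h1 h2|r s h].
- by rewrite skew_constD mulrDl (@scalerDl _ H).
- by rewrite (@scalerDr _ H).
rewrite Rf_ractE -[s *: h]/(skew_const f s *: (h : H)) (@scalerA _ H).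
by rewrite -mulrA skew_x_const mulrA -skew_constM mulrC.
Qed.

Lemma alpha_tens (r : Rf f) (h : symm (restr H)) :
  alpha (tens r h) = (skew_const f r * skew_x f) *: (h : H).
Proof. exact: tensor_lift_tens alpha_bal _ _. Qed.

Lemma alpha1 (h : symm (restr H)) :
  alpha (tens ((1 : R) : Rf f) h) = skew_x f *: (h : H).
Proof. by rewrite alpha_tens skew_const1 mul1r. Qed.

Lemma alpha_linear : linear alpha.
Proof.
have alphaB : {morph alpha : t u / t - u} by apply: tensor_liftB alpha_bal.
move=> r t u; rewrite (morphBD alphaB); congr (_ + _); move: t.
apply: tensor_ext => [t t'|t t'|s h].
- by rewrite scalerBr alphaB.
- by rewrite alphaB scalerBr.
rewrite scale_tens !alpha_tens restr_scaleE (@scalerA _ H) mulrA -skew_constM.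
by [].
Qed.
HB.instance Definition _ := GRing.isLinear.Build R
  (tensor (Rf f) (symm (restr H))) (restr H) *:%R alpha alpha_linear.
End LeftModule.

(* The right R[x, f]-module (M, beta), i.e. a left module over the converse
   ring: m x = beta (m (x) 1) and m (\sum_i r_i x^i) = \sum_i (m r_i) x^i. *)
Definition rmod (R : comNzRingType) (f : {rmorphism R -> R}) (M : lmodType R)
  (beta : rhom (tensor (symm M) (Rf f)) (symm M)) : Type := M.

Section RightModule.
Variables (R : comNzRingType) (f : {rmorphism R -> R}) (M : lmodType R).
Variable beta : rhom (tensor (symm M) (Rf f)) (symm M).

HB.instance Definition _ := GRing.Zmodule.on (rmod beta).

Definition beta_x (m : M) : M :=
  beta (tens (m : symm M) ((1 : R) : Rf f)).

Definition rmod_act (m : M) (q : skew_poly f) : M :=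
  \sum_(i < size (q : {poly R})) iter i beta_x ((q : {poly R})`_i *: m).

Let beta_xD : {morph beta_x : m n / m + n}.
Proof. by move=> m n; rewrite /beta_x tensDl rhomD. Qed.
Let beta_x0 : beta_x 0 = 0.
Proof. by apply: (addIr (beta_x 0)); rewrite -beta_xD !add0r. Qed.
Let beta_xZ r m : r *: beta_x m = beta_x (f r *: m).
Proof.
rewrite /beta_x -[LHS](rhom_ract beta _ r) ract_tens; congr (beta _).
rewrite -[f r *: m]/(ract (m : symm M) (f r)) tens_ract; congr tens.
Qed.
Let iter_xD i : {morph iter i beta_x : m n / m + n}.
Proof. by elim: i => // i IHi m n /=; rewrite IHi beta_xD. Qed.
Let iter0 i : iter i beta_x 0 = 0.
Proof. by elim: i => //= i ->. Qed.
Let iterZ i r m : r *: iter i beta_x m = iter i beta_x (iter i f r *: m).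
Proof.
by elim: i r => // i IHi r /=; rewrite beta_xZ IHi -iterSr.
Qed.

Let act_le n (q : {poly R}) m : (size q <= n)%N ->
  rmod_act m q = \sum_(i < n) iter i beta_x (q`_i *: m).
Proof.
move=> le_qn; rewrite /rmod_act.
rewrite (big_ord_widen n (fun i => iter i beta_x (q`_i *: m))) //.
rewrite big_mkcond /=; apply: eq_bigr => i _.
by case: ltnP => // le_qi; rewrite nth_default ?scale0r ?iter0.
Qed.
Let actDl m (p q : {poly R}) :
  rmod_act m (p + q) = rmod_act m p + rmod_act m q.
Proof.
pose n := maxn (size p) (size q).
rewrite (@act_le n (p + q)) ?size_polyD //.
rewrite (@act_le n p) ?leq_maxl // (@act_le n q) ?leq_maxr //.
rewrite -big_split /=; apply: eq_bigr => i _.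
by rewrite coefD scalerDl iter_xD.
Qed.
Let actDr m n q : rmod_act (m + n) q = rmod_act m q + rmod_act n q.
Proof.
rewrite /rmod_act -big_split /=; apply: eq_bigr => i _.
by rewrite scalerDr iter_xD.
Qed.
Let act0 m : rmod_act m (0 : {poly R}) = 0.
Proof. by rewrite /rmod_act size_poly0 big_ord0. Qed.
Let act_monom m a i :
  rmod_act m (a *: 'X^i : {poly R}) = iter i beta_x (a *: m).
Proof.
have le_s : (size (a *: 'X^i : {poly R}) <= i.+1)%N.
  by rewrite (leq_trans (size_scale_leq _ _)) ?size_polyXn.
rewrite (act_le _ le_s) big_ord_recr /= coefZ coefXn eqxx mulr1.
rewrite big1 ?add0r // => j _.
by rewrite coefZ coefXn (ltn_eqF (ltn_ord j)) mulr0 scale0r iter0.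
Qed.
Let act_0l q : rmod_act 0 q = 0.
Proof. by rewrite /rmod_act big1 // => i _; rewrite scaler0 iter0. Qed.

Let actA (p q : skew_poly f) m :
  rmod_act (rmod_act m p) q = rmod_act m (p * q).
Proof.
elim/skew_poly_ind: p => [|a i p IHp]; first by rewrite mul0r act0 act_0l.
rewrite mulrDl [LHS](congr1 (rmod_act^~ q) (actDl _ _ _)) actDr IHp.
rewrite [RHS]actDl; congr (_ + _); elim/skew_poly_ind: q {IHp} => [|b j q IHq].
  by rewrite mulr0 !act0.
rewrite mulrDr [RHS]actDl [LHS]actDl IHq; congr (_ + _); clear IHq.
have mulE : skew_mul (f := f) (a *: 'X^i : {poly R}) (b *: 'X^j : {poly R}) =
    (a * iter i f b) *: 'X^(i + j) :> {poly R}.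
  rewrite skew_mul_monom.
  have -> : iter i (map_poly f) (b *: 'X^j) = iter i f b *: 'X^j.
    elim: i => //= i ->; rewrite -!mul_polyC rmorphM /= map_polyC map_polyXn.
    by [].
  by rewrite -scalerAl scalerA -exprD addnC.
apply: etrans _ (congr1 (rmod_act m) (esym mulE)).
by rewrite !act_monom iterZ scalerA [(i + j)%N]addnC iterD mulrC.
Qed.

Let rmod_scale (q : (skew_poly f)^c) (m : rmod beta) : rmod beta :=
  rmod_act m q.
Let rmod_scaleA a b v : rmod_scale a (rmod_scale b v) = rmod_scale (a * b) v.
Proof. exact: actA. Qed.
Let rmod_scale1 : left_id 1 rmod_scale.
Proof.
move=> m; rewrite /rmod_scale.
have -> : (1 : (skew_poly f)^c) = 1 *: 'X^0 :> {poly R} by rewrite expr0 scale1r.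
by rewrite act_monom /= scale1r.
Qed.
Let rmod_scaleDr : right_distributive rmod_scale +%R.
Proof. by move=> q m n; apply: actDr. Qed.
Let rmod_scaleDl v : {morph rmod_scale^~ v : a b / a + b}.
Proof. by move=> a b; apply: actDl. Qed.
HB.instance Definition _ := GRing.Zmodule_isLmodule.Build (skew_poly f)^c
  (rmod beta) rmod_scaleA rmod_scale1 rmod_scaleDr rmod_scaleDl.

Lemma rmod_scaleE (q : skew_poly f) (m : rmod beta) :
  (q : (skew_poly f)^c) *: m = rmod_act m q :> M.
Proof. by []. Qed.

Lemma rmod_constE (r : R) (m : rmod beta) :
  (skew_const f r : (skew_poly f)^c) *: m = r *: (m : M) :> M.
Proof.
rewrite rmod_scaleE.
have -> : skew_const f r = r *: 'X^0 :> {poly R} by rewrite expr0 alg_polyC.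
by rewrite act_monom.
Qed.

Lemma rmod_xE (m : rmod beta) :
  (skew_x f : (skew_poly f)^c) *: m = beta (tens (m : symm M) ((1 : R) : Rf f)) :> M.
Proof.
rewrite rmod_scaleE.
have -> : skew_x f = 1 *: 'X^1 :> {poly R} by rewrite scale1r.
by rewrite act_monom scale1r.
Qed.
End RightModule.

(* F is the action on objects, fmor the action on morphisms.  Right modules over
   a ring S are left modules over B = S^c. *)
Record contravariant_functor (A B : pzRingType)
    (F : lmodType A -> lmodType B) := ContravariantFunctor {
  fmor : forall H K : lmodType A, {linear H -> K} -> {linear F K -> F H};
  fmor_id : forall H : lmodType A,
    fmor (idfun : {linear H -> H}) =1 idfun;
  fmor_comp : forall (H K L : lmodType A)
      (phi : {linear H -> K}) (psi : {linear K -> L}),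
    fmor (psi \o phi : {linear H -> L}) =1 fmor phi \o fmor psi
}.

(* Main.v *)
(** Write [m] for an element of [Hom_R(H, I)].  Since [x (a h) = f a * (x h)],
    the map [h |-> m (x h)] is R-linear from [H] to [_f I]; composing it with
    [Psi] and evaluating at [r] therefore gives an element of [Hom_R(H, I)].
    Compatibility of [Psi] with the right actions makes the result balanced in
    [(m, r)], so it factors through the tensor product.  Precomposition with an
    [R[x, f]]-linear map commutes with scalars and with the action of [x], which
    together determine the right [R[x, f]]-module structure. *)
Require Import Defs.
From HB Require Import structures.
From mathcomp Require Import all_boot all_algebra.

Set Implicit Arguments.
Unset Strict Implicit.
Unset Printing Implicit Defensive.
Import GRing.Theory.
Local Open Scope ring_scope.

(** Each term of the action of [q] is an iterate of the action of [x] applied to a scalar multiple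
    of [m], and [u] commutes with both. This is how $R$-linear maps are promoted to $R[x,f]$-linear
    ones. *)
Lemma rmod_act_morph (R : comNzRingType) (f : {rmorphism R -> R})
    (M N : lmodType R) (beta : rhom (tensor (symm M) (Rf f)) (symm M))
    (gamma : rhom (tensor (symm N) (Rf f)) (symm N)) (u : {linear M -> N}) :
    (forall m, u (beta_x beta m) = beta_x gamma (u m)) ->
  forall m q, u (rmod_act beta m q) = rmod_act gamma (u m) q.
Proof.
move=> ux m q; rewrite /rmod_act raddf_sum; apply: eq_bigr => i _.
by rewrite -linearZ; elim: (i : nat) (_ *: m) => //= j IHj n; rewrite ux IHj.
Qed.

Section DualAction.
Variables (R : comNzRingType) (f : {rmorphism R -> R}) (I : lmodType R).
Variable Psi : bimod_iso (fMod f I) (rhom (Rf f) (symm I)).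

Section Object.
Variable H : lmodType (skew_poly f).
Implicit Types (m : dual (restr H) I) (r : Rf f).

Local Notation xact h :=
  (alpha (tens ((1 : R) : Rf f) (h : symm (restr H)))).

Definition dual_act_fun m r (h : restr H) : I :=
  Psi (m (xact h)) r.

Lemma dual_act_linear m r : linear (dual_act_fun m r).
Proof.
move=> a h k.
have xP : xact (a *: h + k) = f a *: xact h + xact k.
  rewrite !alpha1 (@scalerDr _ H); congr (_ + _).
  by rewrite !restr_scaleE !(@scalerA _ H) skew_x_const.
apply: etrans (congr1 (fun z => Psi (m z) r) xP) _.
apply: etrans (congr1 (fun z => Psi z r) (linearP (dual_fun m) _ _ _)) _.
apply: etrans (congr1 (fun g : rhom _ _ => g r) (bimod_isoD Psi _ _)) _.
congr (_ + _).
(* Scaling by [f a] in [I] is, by conversion, scaling by [a] in [fMod f I], so left linearity of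
   [Psi] extracts [a] itself. *)
exact: (congr1 (fun g : rhom _ _ => g r) (bimod_isoZ Psi a _)).
Qed.
HB.instance Definition _ m r :=
  GRing.isLinear.Build R (restr H) I *:%R (dual_act_fun m r)
    (dual_act_linear m r).

Definition dual_act (m : symm (dual (restr H) I)) r : symm (dual (restr H) I) :=
  dual_act_fun m r : {linear restr H -> I}.

Lemma dual_act_balanced : balanced dual_act.
Proof.
split=> [m n r|m r s|m a r]; apply: dual_ext => h.
- exact: (congr1 (fun g : rhom _ _ => g r) (bimod_isoD Psi _ _)).
- exact: (rhomD (Psi (m (xact h))) r s).
(* The right action is plain scaling on [fMod f I] and precomposition on [rhom]:
   [Psi (a *: z) r = Psi z (a *: r)]. *)
exact: (congr1 (fun g : rhom _ _ => g r) (bimod_iso_ract Psi _ a)).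
Qed.

Definition dual_beta_fun :
    tensor (symm (dual (restr H) I)) (Rf f) -> symm (dual (restr H) I) :=
  tensor_lift dual_act.

Lemma dual_beta_tens m r :
  dual_beta_fun (tens (m : symm (dual (restr H) I)) r) = dual_act m r.
Proof. exact: tensor_lift_tens dual_act_balanced _ _. Qed.

Lemma dual_betaD t u : dual_beta_fun (t + u) = dual_beta_fun t + dual_beta_fun u.
Proof. exact: (morphBD (tensor_liftB dual_act_balanced)). Qed.

Lemma dual_beta_ract t s : dual_beta_fun (ract t s) = ract (dual_beta_fun t) s.
Proof.
have dB : {morph dual_beta_fun : t u / t - u}.
  exact: tensor_liftB dual_act_balanced.
move: t; apply: tensor_ext => [t u|t u|m r].
- by rewrite ractDl ractNl dB.
- by rewrite dB ractDl ractNl.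
rewrite ract_tens !dual_beta_tens; apply: dual_ext => h.
(* Here only right linearity of the value of [Psi] is used, not that of [Psi]. *)
exact: (rhom_ract (Psi (m (xact h))) r s).
Qed.

Definition dual_beta := RHom dual_betaD dual_beta_ract.

End Object.

Section Morphism.
Variables (H K : lmodType (skew_poly f)) (phi : {linear H -> K}).

Definition dual_map_fun (m : dual (restr K) I) (h : restr H) : I := m (phi h).

Lemma dual_map_fun_linear m : linear (dual_map_fun m).
Proof.
move=> a h k; rewrite /dual_map_fun.
by rewrite [phi _](linearP phi) (linearP (dual_fun m) a).
Qed.
HB.instance Definition _ m :=
  GRing.isLinear.Build R (restr H) I *:%R (dual_map_fun m)
    (dual_map_fun_linear m).

Definition dual_map (m : dual (restr K) I) : dual (restr H) I :=
  dual_map_fun m : {linear restr H -> I}.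

Lemma dual_map_linear : linear dual_map.
Proof. by move=> a m n; apply: dual_ext. Qed.
HB.instance Definition _ :=
  GRing.isLinear.Build R (dual (restr K) I) (dual (restr H) I) *:%R dual_map
    dual_map_linear.

(** At [h] the two sides apply [Psi] to [m (x (phi h))] and [m (phi (x h))], which agree as [phi]
    commutes with [x]. *)
Lemma dual_map_beta_x m :
  dual_map (beta_x (dual_beta K) m) = beta_x (dual_beta H) (dual_map m).
Proof.
rewrite /beta_x /= !dual_beta_tens; apply: dual_ext => h.
congr (Psi _ _); rewrite /= /dual_map_fun !alpha1.
exact: (congr1 m (esym (linearZ_LR phi _ _))).
Qed.

Definition rmod_dual_map (m : rmod (dual_beta K)) : rmod (dual_beta H) :=
  dual_map m.

Lemma rmod_dual_map_linear : linear rmod_dual_map.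
Proof.
move=> q m n; rewrite [LHS](linearD dual_map); congr (_ + _).
exact: (rmod_act_morph dual_map_beta_x).
Qed.
HB.instance Definition _ :=
  GRing.isLinear.Build (skew_poly f)^c (rmod (dual_beta K)) (rmod (dual_beta H))
    *:%R rmod_dual_map rmod_dual_map_linear.

End Morphism.

Definition dual_functor : contravariant_functor (fun H => rmod (dual_beta H)).
Proof.
apply: (@ContravariantFunctor _ _ (fun H => rmod (dual_beta H))
  (fun H K phi => rmod_dual_map phi)) => [H m|H K L phi psi m];
  exact: dual_ext.
(* Transparency lets [fmor] reduce to precomposition, so the formula on morphisms later holds by
   conversion. *)
Defined.

End DualAction.

Theorem proposition1p13 (R : comNzRingType) (p : nat)
    (charRp : p \in [pchar R]) (noethR : noetherian R)
    (FfinR : F_finite charRp) (I : lmodType R) (injI : injective_module I)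
    (Psi : bimod_iso (fMod (frobenius charRp) I)
                     (rhom (Rf (frobenius charRp)) (symm I))) :
  exists Dalpha : forall H : lmodType (skew_poly (frobenius charRp)),
      rhom (tensor (symm (dual (restr H) I)) (Rf (frobenius charRp)))
           (symm (dual (restr H) I)),
    (forall (H : lmodType (skew_poly (frobenius charRp)))
            (m : dual (restr H) I) (r : Rf (frobenius charRp)) (h : restr H),
       (Dalpha H (tens (m : symm (dual (restr H) I)) r) : dual (restr H) I) h =
       Psi (m (alpha (tens ((1 : R) : Rf (frobenius charRp))
                           (h : symm (restr H))))) r)
    /\
    exists D : contravariant_functor (fun H => rmod (Dalpha H)),
      forall (H K : lmodType (skew_poly (frobenius charRp)))
             (phi : {linear H -> K}) (m : dual (restr K) I) (h : restr H),
        (fmor D phi m : dual (restr H) I) h = m (phi h).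
Proof.
exists (dual_beta Psi); split=> [H m r h|]; first by rewrite /= dual_beta_tens.
by exists (dual_functor Psi).
Qed.
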